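(* Graphs that are $\gamma_g$-perfect can be recognized in polynomial time; that is, there is an algorithm which, given an arbitrary graph $G$, decides whether $G$ is $\gamma_g$-perfect in time polynomial in the size of $G$.
   Context: Graphs are finite, simple, undirected, with at least one vertex, not necessarily connected. $\gamma(G)$ is the domination number of $G$. Domination game on $G$: Dominator and Staller alternately select vertices; each selected vertex must dominate (i.e. contain in its closed neighborhood) at least one vertex not dominated by the previously selected vertices. The game ends when no legal move exists. Dominator wants to minimize and Staller to maximize the total number of moves. $\gamma_g(G)$ is the number of moves under optimal play when Dominator starts. $G$ is $\gamma_g$-perfect if every induced subgraph $F$ of $G$ satisfies $\gamma_g(F)=\gamma(F)$. *)

(* Defs.v *)
From mathcomp Require Import all_boot ssralg poly.

Set Implicit Arguments.
Unset Strict Implicit.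
Unset Printing Implicit Defensive.

Record sgraph := SGraph {
  vertex :> finType;
  edge : rel vertex;
  edge_sym : symmetric edge;
  edge_irrefl : irreflexive edge
}.

Section Induced.
Variables (G : sgraph) (A : {set G}).

Definition induced_edge : rel {x : G | x \in A} :=
  [rel x y | edge (val x) (val y)].

Lemma induced_edge_sym : symmetric induced_edge.
Proof. by move=> x y; exact: edge_sym. Qed.

Lemma induced_edge_irrefl : irreflexive induced_edge.
Proof. by move=> x; exact: edge_irrefl. Qed.

Definition induced : sgraph := SGraph induced_edge_sym induced_edge_irrefl.

End Induced.

Section Domination.
Variable G : sgraph.

Definition closed_neighborhood (v : G) : {set G} := [set w | (w == v) || edge v w].

Definition dominated (S : {set G}) : {set G} :=
  \bigcup_(v in S) closed_neighborhood v.

Definition dominating (S : {set G}) : bool := dominated S == [set: G].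

Definition gamma : nat := #|[arg min_(S < [set: G] | dominating S) #|S|]|.

Definition legal (S : {set G}) (v : G) : bool :=
  ~~ (closed_neighborhood v \subset dominated S).

Inductive player := Dominator | Staller.

(* [game_value n p S] is the number of moves still to be made under optimal
   play when the vertices of [S] have been selected and [p] is to move.  The
   fuel [n] only serves termination: a legal move is never in [S], so a game
   starting from [set0] has at most #|G| moves.  A value computed with fuel [n]
   is at most [n], so the neutral element [n] of the minimum is harmless. *)
Fixpoint game_value (n : nat) (p : player) (S : {set G}) : nat :=
  if n isn't n'.+1 then 0 else
  if [exists v, legal S v] then
    match p with
    | Dominator =>
        (\big[minn/n']_(v | legal S v) game_value n' Staller (v |: S)).+1
    | Staller =>
        (\max_(v | legal S v) game_value n' Dominator (v |: S)).+1
    end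
  else 0.

Definition gamma_g : nat := game_value #|G| Dominator set0.

End Domination.

Definition gamma_g_perfect (G : sgraph) : Prop :=
  forall A : {set G}, A != set0 -> gamma_g (induced A) = gamma (induced A).

(* The model of computation is a random access machine programmed by while
   programs.  A state consists of registers, which programs name directly, and
   of a memory accessed by computed addresses; all cells hold natural numbers.
   Time is the number of elementary operations (uniform cost).  There is no
   multiplication, so t operations only produce numbers of O(t) bits beyond
   those of the input; hence polynomial time is the same here as on Turing
   machines. *)
Inductive expr :=
  | Const of nat
  | Reg of nat
  | Mem of expr
  | Add of expr & expr
  | Sub of expr & expr.

Inductive prog :=
  | Skip
  | SetReg of nat & expr
  | Store of expr & expr
  | Seq of prog & prog
  | If of expr & prog & prog
  | While of expr & prog.

Record state := State { regs : nat -> nat; mem : nat -> nat }.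

Fixpoint eval (s : state) (e : expr) : nat :=
  match e with
  | Const k => k
  | Reg r => regs s r
  | Mem a => mem s (eval s a)
  | Add a b => eval s a + eval s b
  | Sub a b => eval s a - eval s b
  end.

Fixpoint cost (e : expr) : nat :=
  match e with
  | Const _ | Reg _ => 1
  | Mem a => (cost a).+1
  | Add a b | Sub a b => (cost a + cost b).+1
  end.

Definition set_reg (s : state) (r x : nat) : state :=
  State [eta regs s with r |-> x] (mem s).

Definition set_mem (s : state) (a x : nat) : state :=
  State (regs s) [eta mem s with a |-> x].

(* [exec c s t s']: started in [s], the program [c] halts in [s'] after time
   exactly [t]. *)
Inductive exec : prog -> state -> nat -> state -> Prop :=
  | exec_Skip s : exec Skip s 1 s
  | exec_SetReg r e s :
      exec (SetReg r e) s (cost e).+1 (set_reg s r (eval s e))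
  | exec_Store a e s :
      exec (Store a e) s (cost a + cost e).+1 (set_mem s (eval s a) (eval s e))
  | exec_Seq c1 c2 s1 s2 s3 t1 t2 :
      exec c1 s1 t1 s2 -> exec c2 s2 t2 s3 ->
      exec (Seq c1 c2) s1 (t1 + t2).+1 s3
  | exec_If e c1 c2 s t s' :
      exec (if eval s e != 0 then c1 else c2) s t s' ->
      exec (If e c1 c2) s (cost e + t).+1 s'
  | exec_While_stop e c s :
      eval s e = 0 -> exec (While e c) s (cost e).+1 s
  | exec_While_loop e c s1 s2 s3 t1 t2 :
      eval s1 e != 0 -> exec c s1 t1 s2 -> exec (While e c) s2 t2 s3 ->
      exec (While e c) s1 (cost e + t1 + t2).+1 s3.

(* The order of [G] is in register 0 and its adjacency matrix is in memory, in
   row-major order from address 0; everything else is 0. *)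
Definition input_state (G : sgraph) : state :=
  State [eta fun _ => 0 with 0 |-> #|G|]
        (nth 0 [seq nat_of_bool (edge x y) | x <- enum G, y <- enum G]).

Definition accepting (s : state) : Prop := regs s 0 <> 0.

Definition polynomial_time_recognizable (P : sgraph -> Prop) : Prop :=
  exists (c : prog) (p : {poly nat}), forall G : sgraph, 0 < #|G| ->
    exists (t : nat) (s : state),
      [/\ exec c (input_state G) t s, t <= (p.[#|G|])%R
        & accepting s <-> P G].

(* Main.v *)
(** Call [v] good in [A] when no obstruction in the sense below occurs.  Up to
true twins, the non-neighbours of a good vertex are pairwise at distance at
least three: once such a vertex is played, every later move dominates exactly
one twin class, so the game length no longer depends on the play.  The rest of
the definition ensures that a good vertex or one of its neighbours is an optimal
first move.  Goodness passes to induced subgraphs, hence every induced subgraph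
containing a good vertex has equal game domination and domination numbers, and
good vertices may be deleted greedily.

Conversely, every nonempty perfect graph has a good vertex.  Only the subgraphs
with domination number at most 2 matter: there the first optimal move [s] has
a non-neighbourhood made of true twins.  Take two vertices whose closed
neighbourhoods cover a set [F] of maximum size and let [s] be such a vertex of
[F].  By maximality the rest of [F] is a twin class, represented by [t], that
lies at distance at least three from everything outside [F].  By induction
there is a suitable vertex in the graph without [t], and either it or [s] is
suitable in the whole graph.

The algorithm repeats, as often as there are vertices, a pass that deletes
every good vertex it meets, testing all 6-tuples for an obstruction. *)

Require Import Defs.
From mathcomp Require Import all_boot ssralg poly.
From mathcomp Require Import zify.

Set Implicit Arguments.
Unset Strict Implicit.
Unset Printing Implicit Defensive.

(** * Good vertices and the domination game *)

(* [a] is closed adjacency, [u] and [u'] are non-neighbours of [v].  If [a w u']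
   then [u] and [u'] have the common neighbour [w] and are separated by [w'].
   Otherwise [w] and [w'] attach to different twin classes while their traces on
   the closed neighbourhood of [v] are incomparable, as witnessed by [x] and [y]. *)
Definition obstruction (T : Type) (a : rel T) (v u u' w w' x y : T) : bool :=
  [&& ~~ a v u, ~~ a v u', a w u, a w' u' &
      if a w u' then ~~ a w' u
      else [&& a v w, a v w', a v x, a v y,
               a w x, ~~ a w' x, a w' y & ~~ a w y]].

(** * Domination in terms of closed adjacency *)

Section GraphTheory.
Variable G : sgraph.
Implicit Types (A B D F S : {set G}) (a b s t u v w x y z : G).

Definition adj v w := (w == v) || edge v w.

Lemma in_closed_neighborhood v w : (w \in closed_neighborhood v) = adj v w.
Proof. by rewrite inE. Qed.

Lemma adj_sym : symmetric adj.
Proof. by move=> v w; rewrite /adj /= eq_sym edge_sym. Qed.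

Lemma adjxx v : adj v v.
Proof. by rewrite /adj /= eqxx. Qed.

Lemma dominatedP S x :
  reflect (exists2 v, v \in S & adj v x) (x \in dominated S).
Proof.
by apply: (iffP bigcupP) => -[v vS vx]; exists v; rewrite ?in_closed_neighborhood // in vx *.
Qed.

Lemma dominatedU1 v S x : (x \in dominated (v |: S)) = adj v x || (x \in dominated S).
Proof.
apply/dominatedP/orP => [[w /setU1P[-> ? | wS wx]]|[vx|/dominatedP[w wS wx]]].
- by left.
- by right; apply/dominatedP; exists w.
- by exists v; rewrite ?setU11.
- by exists w; rewrite ?setU1r.
Qed.

Lemma dominated1 v x : (x \in dominated [set v]) = adj v x.
Proof. by rewrite /dominated big_set1 in_closed_neighborhood. Qed.

Lemma dominated0 x : (x \in dominated (set0 : {set G})) = false.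
Proof. by rewrite /dominated big_set0 inE. Qed.

Lemma legalP S v : reflect (exists2 x, adj v x & x \notin dominated S) (legal S v).
Proof.
apply: (iffP subsetPn) => -[x vx xS]; exists x; rewrite ?in_closed_neighborhood // in vx *.
Qed.

Lemma dominating_setT : dominating [set: G].
Proof.
by apply/eqP/setP => x; rewrite inE; apply/dominatedP; exists x; rewrite ?inE ?adjxx.
Qed.

Lemma gamma_le D : dominating D -> gamma G <= #|D|.
Proof. by rewrite /gamma; case: arg_minnP => [|E _]; [exact: dominating_setT|exact]. Qed.

Lemma gamma_attained : exists2 D : {set G}, dominating D & gamma G = #|D|.
Proof. by rewrite /gamma; case: arg_minnP => [|E ? _]; [exact: dominating_setT|exists E]. Qed.

(** * Bounds on the length of the game *)

Lemma bigmin_ex (I : finType) (P : pred I) (f : I -> nat) m k :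
  \big[minn/m]_(i | P i) f i <= k -> k < m -> exists2 i, P i & f i <= k.
Proof.
move=> le_k lt_m.
have /existsP[i /andP[]] : [exists i, P i && (f i <= k)]; last by exists i.
apply: contraLR le_k => /existsPn none; rewrite -ltnNge.
elim/big_rec: _ => // i r Pi; rewrite leq_min => ->.
by move: (none i); rewrite Pi -ltnNge => ->.
Qed.

Lemma bigmin_le (I : finType) (P : pred I) (f : I -> nat) m i :
  P i -> \big[minn/m]_(j | P j) f j <= f i.
Proof.
move=> Pi; have := mem_index_enum i; elim: (index_enum I) => // j r IHr.
rewrite inE big_cons => /predU1P[<-|/IHr le_i]; first by rewrite Pi geq_minl.
by case: ifP => // _; rewrite geq_min le_i orbT.
Qed.

Lemma no_legal S : ~~ [exists v, legal S v] -> dominating S.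
Proof.
move=> /existsPn noS; apply/eqP/setP => x; rewrite inE; apply: contraT => xS.
by have /legalP[] := noS x; exists x; rewrite ?adjxx.
Qed.

(** The vertices selected by the end form a dominating set; the hypothesis provides enough fuel to
    reach the end. *)
Lemma game_value_ge n p S : #|G| <= n + #|S| -> gamma G <= game_value n p S + #|S|.
Proof.
have gamma_G : gamma G <= #|G| by rewrite -cardsT gamma_le ?dominating_setT.
elim: n p S => [|n IHn] p S leG /=; first exact: leq_trans leG.
case: ifPn => [/existsP[v0 legv0]|/no_legal/gamma_le //].
have IH q v : legal S v -> gamma G <= (game_value n q (v |: S)).+1 + #|S|.
  move=> /legalP[x vx xS]; have vS : v \notin S.
    by apply: contra xS => vS; apply/dominatedP; exists v.
  by have := IHn q (v |: S); rewrite cardsU1 vS add1n !addnS addSn; apply; rewrite addSn in leG.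
case: p; last first.
  by apply: leq_trans (IH Dominator v0 legv0) _; rewrite leq_add2r ltnS; exact: leq_bigmax_cond.
rewrite leqNgt addSn; apply/negP => lt_gamma.
set m := \big[minn/n]_(v | _) _ in lt_gamma.
(* Were the minimum at least its neutral element [n], the total would already reach [#|G|], hence
   [gamma G]. *)
have [lemn|] := leqP n m.
  have := leq_trans lt_gamma (leq_trans gamma_G leG).
  by rewrite addSn !ltnS ltn_add2r ltnNge lemn.
case/(bigmin_ex (leqnn m)) => v legv lem.
have := leq_trans lt_gamma (IH Staller v legv).
by rewrite addSn !ltnS ltn_add2r ltnNge lem.
Qed.

Lemma gamma_g_ge : gamma G <= gamma_g G.
Proof. by have := @game_value_ge #|G| Dominator set0; rewrite cards0 !addn0; apply. Qed.

(* Every legal move newly dominates exactly what some vertex of [D] does, so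
   the players use up [D] one vertex per move, whatever they play. *)
Lemma game_value_le n p S D :
    (forall u u' w z, u \notin dominated S -> u' \notin dominated S ->
       adj w u -> adj w u' -> adj z u -> adj z u') ->
    (forall u, u \notin dominated S -> u \in dominated D) ->
  game_value n p S <= #|D|.
Proof.
elim: n p S D => [|n IHn] p S D twinS domD //=.
case: ifP => // /existsP[v0 legv0].
have IH q v : legal S v -> game_value n q (v |: S) < #|D|.
  case/legalP=> u vu uS; have /dominatedP[d dD du] := domD u uS.
  rewrite (cardsD1 d) dD add1n ltnS; apply: IHn => [u1 u2 w z|u1].
    by rewrite !dominatedU1 !negb_or => /andP[_ ?] /andP[_ ?]; apply: twinS.
  rewrite dominatedU1 negb_or => /andP[vu1 u1S].
  have /dominatedP[e eD eu1] := domD u1 u1S.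
  apply/dominatedP; exists e; rewrite // !inE eD andbT.
  (* If [d] dominated [u1], then [u] and [u1] would be twins through [d], and [v], adjacent to [u],
     would dominate [u1] too. *)
  apply: contraNneq vu1 => eqed; rewrite eqed in eu1.
  exact: (twinS u u1 d v).
case: p.
  by apply: leq_ltn_trans (IH Staller v0 legv0); exact: bigmin_le.
rewrite -(prednK (leq_trans _ (IH Staller v0 legv0))) // ltnS.
by apply/bigmax_leqP => v legv; rewrite -ltnS (prednK (leq_trans _ (IH Dominator v legv))) ?IH.
Qed.

Lemma gamma_g_le v D :
    (forall u u' w z, ~~ adj v u -> ~~ adj v u' ->
       adj w u -> adj w u' -> adj z u -> adj z u') ->
    (forall u, ~~ adj v u -> u \in dominated D) ->
  gamma_g G <= #|D|.+1.
Proof.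
move=> twin domD; rewrite /gamma_g.
have : 0 < #|G| by apply/card_gt0P; exists v.
case: #|G| => // n _ /=; case: ifP => // _; rewrite ltnS.
have legv : legal set0 v by apply/legalP; exists v; rewrite ?adjxx ?dominated0.
apply: leq_trans (bigmin_le _ _ legv) _; rewrite setU0.
by apply: game_value_le => [u u' w z|u]; rewrite !dominated1; [exact: twin|exact: domD].
Qed.

(** * Good vertices and equality of the two numbers *)

Definition good A v := v \in A /\
  forall u u' w w' x y, u \in A -> u' \in A -> w \in A -> w' \in A ->
    x \in A -> y \in A -> ~~ obstruction adj v u u' w w' x y.

Lemma good_sub A B v : B \subset A -> v \in B -> good A v -> good B v.
Proof. by move=> /subsetP sBA vB [_ gA]; split=> // *; apply: gA; exact: sBA. Qed.

(** One inclusion suffices: exchanging [u] and [u'] gives the other, so such [u] and [u'] are true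
    twins in [A]. *)
Definition spread A v := v \in A /\
  forall u u' w z, u \in A -> u' \in A -> w \in A -> z \in A ->
    ~~ adj v u -> ~~ adj v u' -> adj w u -> adj w u' -> adj z u -> adj z u'.

Lemma good_spread A v : good A v -> spread A v.
Proof.
case=> vA gA; split=> // u u' w z uA u'A wA zA vu vu' wu wu' zu.
have := gA u' u w z v v u'A uA wA zA vA vA.
by rewrite /obstruction vu vu' wu wu' zu /= negbK.
Qed.

(** Take a minimum dominating set [D]. If some vertex of [D] can be spared in dominating the
    non-neighbours of [v], Dominator opens with [v]; otherwise with some [w] in [D] whose closed
    neighbourhood contains that of [v]. *)
Lemma good_gamma_g v : good [set: G] v -> gamma_g G = gamma G.
Proof.
move=> gv; have [_ spv] := good_spread gv.
have twin u u' w z : ~~ adj v u -> ~~ adj v u' ->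
    adj w u -> adj w u' -> adj z u -> adj z u' by apply: spv.
apply/eqP; rewrite eqn_leq gamma_g_ge andbT.
have [D domD ->] := gamma_attained.
have Dall x : x \in dominated D by rewrite (eqP domD) inE.
have shift w : w \in D ->
    (forall u, ~~ adj w u -> ~~ adj v u) -> gamma_g G <= #|D|.
  move=> wD sub; rewrite (cardsD1 w) wD add1n; apply: (@gamma_g_le w).
    by move=> u u' w' z wu wu'; apply: twin; exact: sub.
  move=> u wu; have /dominatedP[d dD du] := Dall u; apply/dominatedP; exists d => //.
  by rewrite !inE dD andbT; apply: contraNneq wu => <-.
have [/existsP[d /andP[dD /forallP unneeded]] | /existsPn needed] :=
  boolP [exists d in D, forall u, ~~ adj v u ==> (u \in dominated (D :\ d))].
  rewrite (cardsD1 d) dD add1n; apply: (@gamma_g_le v) => // u vu.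
  exact: implyP (unneeded u) vu.
have private d : d \in D -> exists2 u, ~~ adj v u &
    adj d u /\ forall e, e \in D -> adj e u -> e = d.
  move=> dD; have := needed d; rewrite dD /= => /forallPn[u]; rewrite negb_imply.
  case/andP=> vu nu; have only e : e \in D -> adj e u -> e = d.
    move=> eD eu; apply: contraNeq nu => ned; apply/dominatedP; exists e => //.
    by rewrite !inE ned.
  by exists u => //; split=> //; have /dominatedP[e eD eu] := Dall u; rewrite -(only e).
have /dominatedP[d0 d0D d0v] := Dall v; rewrite adj_sym in d0v.
pose P w := (w \in D) && adj v w.
have Pd0 : P d0 by rewrite /P d0D.
(* Choose [w] with the largest trace on the closed neighbourhood of [v]; an [x] missing from this
   trace leads to an obstruction. *)
case: (arg_maxnP (fun w => #|[set x | adj v x && adj w x]|) Pd0) => w /andP[wD vw] maxw.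
apply: (shift w wD) => x; apply: contra => vx; apply: contraT => nwx.
have [u vu [wu onlyw]] := private w wD.
have /dominatedP[d dD dx] := Dall x.
have ndw : d != w by apply: contraNneq nwx => <-.
have [u' vu' [du' onlyd]] := private d dD.
have nwu' : ~~ adj w u' by apply: contra ndw => wu'; rewrite (onlyd w).
have [_ gA] := gv.
have [vd|nvd] := boolP (adj v d).
  (* A [y] in the trace of [w] but not of [d] would complete an obstruction, so [d] has a strictly
     larger trace. *)
  have : [set y | adj v y && adj w y] \proper [set y | adj v y && adj d y].
    apply/properP; split; last by exists x; rewrite inE vx //= ?negb_and.
    apply/subsetP => y; rewrite !inE => /andP[vy wy]; rewrite vy; apply: contraT => ndy.
    have := gA u u' w d y x; rewrite !inE /obstruction => /(_ isT isT isT isT isT isT).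
    by rewrite vu vu' wu du' (negbTE nwu') vw vd vy vx wy ndy dx nwx.
  by move/proper_card; rewrite ltnNge => /negP[]; apply: maxw; rewrite /P dD.
have nwd : ~~ adj w d.
  by apply: contra nwu' => wd; apply: (twin d u' d w) => //; exact: adjxx.
(* Here [d] itself is the second non-neighbour of [v], reached through [x]. *)
have := gA u d w x w x; rewrite !inE /obstruction => /(_ isT isT isT isT isT isT).
by rewrite vu nvd wu (adj_sym x) dx (negbTE nwd) vw vx !adjxx (adj_sym x) nwx.
Qed.

(** * Existence of good vertices in perfect graphs *)

Definition cotwin F s := forall t t' z, t \in F -> t' \in F -> z \in F ->
  ~~ adj s t -> ~~ adj s t' -> adj z t -> adj z t'.

(** After an optimal first move [s], any reply of Staller must end the game, so it dominates
    everything that [s] left. *)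
Lemma gamma_g_le2 : 0 < #|G| -> gamma_g G <= 2 -> exists s, cotwin setT s.
Proof.
case/card_gt0P=> s0 _; rewrite /gamma_g.
(* From three vertices on, the default of the minimum exceeds 1, so a move attains the minimum;
   below, [s0] has at most one non-neighbour. *)
case En : #|G| => [|[|[|n]]] game_le2.
1-3: exists s0 => t t' z _ _ _ s0t s0t'; suff -> : t = t' by [].
1-3: apply/eqP; apply: contraT => ntt'.
1-3: have : #|[set s0; t; t']| <= 2 by apply: leq_trans (max_card _) _; rewrite En.
1-3: rewrite -setUA cardsU1 cards2 ntt' !inE negb_or.
1-3: by rewrite -!negb_or; case: eqP s0t => [->|_]; rewrite ?adjxx //; case: eqP s0t' => [->|_];
  rewrite ?adjxx.
have no_legal0 m p S : game_value m.+1 p S = 0 -> forall v, ~~ legal S v.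
  by move=> /=; case: ifPn => [_|/existsPn //]; case: p.
have : game_value n.+3 Dominator (set0 : {set G}) <= 2 by [].
rewrite [X in X <= _ -> _]/=; case: ifPn => [_|/no_legal]; last first.
  by move/eqP/setP/(_ s0); rewrite dominated0 inE.
rewrite ltnS => /bigmin_ex[] // s _; rewrite setU0 => /= val_s.
exists s => t t' z _ _ _ st st' zt; apply: contraT => zt'.
have leg : legal [set s] z by apply/legalP; exists t; rewrite ?dominated1.
move: val_s; case: ifPn => [_|/existsPn/(_ z)]; last by rewrite leg.
rewrite ltnS => /bigmax_leqP/(_ z leg); rewrite leqn0 => /eqP val0.
have /negP[] := no_legal0 n Dominator _ val0 t'.
by apply/legalP; exists t'; rewrite ?adjxx // dominatedU1 dominated1 (negbTE zt').
Qed.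

Definition two_perfect := forall F a b, a \in F -> b \in F ->
  (forall x, x \in F -> adj a x || adj b x) -> exists2 s, s \in F & cotwin F s.

(* [cov a b] is the part of [A] covered by [a] and [b], and [F] is a largest one;
   [maxcov] is then used to bound neighbourhoods, and in the end to show that the
   vertex [v] obtained by induction has no neighbour outside [F] ([viaS]). *)
Lemma spread_exists A : two_perfect -> A != set0 -> exists v, spread A v.
Proof.
move=> perf2; have [m] := ubnP #|A|; elim: m A => // m IHm A; rewrite ltnS => cardA nA.
have IH t : t \in A -> A :\ t != set0 -> exists v, spread (A :\ t) v.
  by move=> tA; apply: IHm; move: cardA; rewrite (cardsD1 t) tA.
have [/existsP[z /existsP[z' /and4P[zA z'A nzz' /forall_inP twinz]]] | /existsPn twinfree] :=
  boolP [exists z, exists z', [&& z \in A, z' \in A, z != z' &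
                                 [forall x in A, adj x z == adj x z']]].
  have z'A1 : z' \in A :\ z by rewrite !inE eq_sym nzz'.
  have [|v [vA spv]] := IH z zA; first by apply/set0Pn; exists z'.
  have [nvz vA0] := setD1P vA; exists v; split=> // u u' w y uA u'A wA yA.
  (* Replacing [z] by its true twin [z'] preserves adjacency, so [v] also works with [z] put
     back. *)
  pose r x := if x == z then z' else x.
  have rA x : x \in A -> r x \in A :\ z.
    by rewrite /r !inE; case: (eqVneq x z) => [_ _|nxz xA]; rewrite ?(eq_sym z') ?nzz' ?nxz.
  have adjr x1 x2 : x1 \in A -> x2 \in A -> adj x1 x2 = adj (r x1) (r x2).
    move=> x1A x2A; rewrite /r; have e x : x \in A -> adj x z = adj x z' by move/twinz/eqP.
    case: eqP => [->|_]; case: eqP => [->|_] //; rewrite ?e //.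
      by rewrite adj_sym e // adjxx adjxx.
    by rewrite adj_sym e // adj_sym.
  have rv : r v = v by rewrite /r (negbTE nvz).
  rewrite (adjr v u) // (adjr v u') // (adjr w u) // (adjr w u') // (adjr y u) // (adjr y u') //.
  rewrite rv; apply: spv; exact: rA.
have {}twinfree z z' : z \in A -> z' \in A ->
    (forall x, x \in A -> adj x z = adj x z') -> z = z'.
  move=> zA z'A twin; apply/eqP; apply: contraT => nzz'.
  have /existsPn/(_ z') := twinfree z; rewrite zA z'A nzz' /= => /forall_inPn[x xA].
  by rewrite twin ?eqxx.
pose cov a b := [set x in A | adj a x || adj b x].
have [a0 a0A] := set0Pn _ nA.
pose P (p : G * G) := (p.1 \in A) && (p.2 \in A).
have P0 : P (a0, a0) by rewrite /P a0A.
case: (arg_maxnP (fun p => #|cov p.1 p.2|) P0) => -[a b] /andP[/= aA bA] maxF.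
set F := cov a b in maxF.
have maxcov c d : c \in A -> d \in A -> F \subset cov c d -> cov c d \subset F.
  move=> cA dA sF; have /eqP-> // : F == cov c d.
  by rewrite eqEcard sF (maxF (c, d)) // /P cA dA.
have FA x : x \in F -> x \in A by rewrite inE => /andP[].
have aF : a \in F by rewrite inE aA adjxx.
have bF : b \in F by rewrite inE bA adjxx orbT.
have [|s sF cotw] := perf2 F a b aF bF; first by move=> x; rewrite inE => /andP[].
have sA := FA s sF.
have [/existsP[t /andP[tF st]] | /existsPn univ] := boolP [exists t in F, ~~ adj s t]; last first.
  have univF x : x \in F -> adj s x by move=> xF; have := univ x; rewrite xF negbK.
  (* [s] alone covers [F], so by maximality no [u] lies outside [F]: [s] is adjacent to all of
     [A]. *)
  exists s; split=> // u u' w z uA _ _ _ /negP[].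
  apply: (univF); have/subsetP-> // : cov s u \subset F.
    apply: maxcov => //; apply/subsetP => x xF.
    by rewrite inE FA //= univF.
  by rewrite inE uA adjxx orbT.
have covst t1 : t1 \in F -> ~~ adj s t1 -> cov s t1 \subset F.
  move=> t1F st1; apply: maxcov; rewrite ?FA //; apply/subsetP => x xF.
  rewrite inE FA //=; have [//|sx /=] := boolP (adj s x).
  by rewrite adj_sym; apply: (cotw x t1 x) => //; exact: adjxx.
have tA := FA t tF.
(* By [covst] the neighbours of [x] and [t] stay in [F], so these twins in [F] are twins in [A] and
   coincide. *)
have onlyt x : x \in F -> ~~ adj s x -> x = t.
  move=> xF sx; apply: twinfree; rewrite ?FA // => y yA.
  have yF : adj y x || adj y t -> y \in F.
    rewrite !(adj_sym y) => /orP[] yt.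
      by apply: (subsetP (covst x xF sx)); rewrite inE yA yt orbT.
    by apply: (subsetP (covst t tF st)); rewrite inE yA yt orbT.
  by apply/idP/idP => yt; apply: cotw (yt) => //; apply: yF; rewrite yt ?orbT.
have Fcov c d : adj c t || adj d t ->
    (forall x, x \in A -> x != t -> adj s x -> adj c x || adj d x) -> F \subset cov c d.
  move=> covt covs; apply/subsetP => x xF; rewrite inE FA //=.
  have [->//|nxt] := eqVneq x t; apply: covs; rewrite ?FA //.
  by apply: contraNT nxt => sx; rewrite (onlyt x).
(* [s] and a neighbour [w] of [t] already cover [F], so [w] has no neighbour outside [F]. *)
have far w r : w \in A -> adj w t -> r \in A -> adj w r -> r \in F.
  move=> wA wt rA wr; apply: (subsetP (maxcov s w sA wA _)).
    by apply: Fcov; rewrite ?wt ?orbT // => x _ _ ->.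
  by rewrite inE rA wr orbT.
have nearF r : r \in F -> r != t -> adj s r.
  by move=> rF; apply: contraNT => sr; rewrite (onlyt r).
have nst : s != t by apply: contraNneq st => ->; exact: adjxx.
have D1 x : x \in A -> x != t -> x \in A :\ t by rewrite !inE => -> ->.
have [|v [vA1 spv]] := IH t tA; first by apply/set0Pn; exists s; exact: D1.
have [nvt vA] := setD1P vA1.
(* Non-neighbours of [s] are [t], which is far from the complement of [F], and vertices outside [F],
   which are non-neighbours of [v]. *)
have viaS : (forall r, r \in A -> adj v r -> r \in F) -> exists v, spread A v.
  move=> vF; exists s; split=> // u u' w z uA u'A wA zA su su' wu wu' zu.
  have [eut|nut] := eqVneq u t.
    rewrite eut in wu zu; have -> // : u' = t by apply: onlyt => //; exact: (far w).
  have nuF : u \notin F by apply: contra su => uF; apply: nearF.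
  have ntu w1 : w1 \in A -> adj w1 t -> ~~ adj w1 u.
    by move=> w1A w1t; apply: contra nuF => w1u; exact: (far w1).
  have nu't : u' != t by apply: contraTneq wu => eu't; apply: ntu; rewrite -?eu't.
  have nu'F : u' \notin F by apply: contra su' => u'F; apply: nearF.
  have nwt : w != t by apply: contraTneq wu => ->; apply: ntu; rewrite ?adjxx.
  have nzt : z != t by apply: contraTneq zu => ->; apply: ntu; rewrite ?adjxx.
  apply: (spv u u' w z) => //; try exact: D1.
    by apply: contra nuF; exact: vF.
  by apply: contra nu'F; exact: vF.
have [vt|nvt'] := boolP (adj v t); first by apply: viaS => r; exact: far.
(* If no other non-neighbour [u] of [v] shares a neighbour with [t], then [v] stays spread when [t]
   is put back. *)
have [/existsP[u /andP[/setD1P[nut uA] /andP[vu /existsP[w /and3P[wA wt wu]]]]] | /existsPn none] :=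
    boolP [exists u in A :\ t,
             ~~ adj v u && [exists w, [&& w \in A, adj w t & adj w u]]]; last first.
  have {}none u w : u \in A -> u != t -> ~~ adj v u -> w \in A -> adj w t -> ~~ adj w u.
    move=> uA nut vu wA wt; have := none u; rewrite D1 // vu /= => /existsPn/(_ w).
    by rewrite wA wt.
  exists v; split=> // u u' w z uA u'A wA zA vu vu' wu wu' zu.
  have [eut|nut] := eqVneq u t.
    have [->|nu't] := eqVneq u' t; first by rewrite -eut.
    by have := none u' w u'A nu't vu' wA; rewrite -eut wu wu' => /(_ isT).
  have ntu w1 : w1 \in A -> adj w1 t -> ~~ adj w1 u by apply: none.
  have nu't : u' != t by apply: contraTneq wu => eu't; apply: ntu; rewrite -?eu't.
  have nwt : w != t by apply: contraTneq wu => ->; apply: ntu; rewrite ?adjxx.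
  have nzt : z != t by apply: contraTneq zu => ->; apply: ntu; rewrite ?adjxx.
  by apply: (spv u u' w z) => //; exact: D1.
have su : adj s u by apply: nearF => //; exact: (far w).
(* Once [v] and some [q] cover [F], maximality confines the neighbours of [v] to [F]. *)
have [q qA1 qt] : exists2 q, q \in A :\ t & adj q t /\ F \subset cov v q.
  have [sv|nsv] := boolP (adj s v).
    have twin x y : x \in A -> y \in A -> x != t -> y != t -> adj s x -> adj s y ->
        ~~ adj v x -> ~~ adj v y -> forall z, z \in A :\ t -> adj z x -> adj z y.
      by move=> xA yA nxt nyt sx sy vx vy z zA; apply: (spv x y s z) => //; exact: D1.
    (* By [twin], [q] need only be adjacent to [t] and to one uncovered vertex: either [q] is itself
       uncovered by [v], or [w] serves through [u]. *)
    have [/existsP[q /and4P[qA nqt qt nvq]] | /existsPn none] :=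
        boolP [exists q, [&& q \in A, q != t, adj q t & ~~ adj v q]].
      exists q; [exact: D1|split=> //; apply: Fcov; rewrite ?qt ?orbT // => x xA nxt sx].
      have sq : adj s q by apply: nearF => //; apply: (far q) => //; exact: adjxx.
      have [//|vx /=] := boolP (adj v x); rewrite adj_sym.
      by apply: (twin x q) => //; [exact: D1|exact: adjxx].
    have nwt : w != t.
      apply: contraNneq vu => ewt; have := none u; rewrite uA nut -ewt adj_sym wu /=.
      by rewrite negbK.
    exists w; [exact: D1|split=> //; apply: Fcov; rewrite ?wt ?orbT // => x xA nxt sx].
    have [//|vx /=] := boolP (adj v x).
    by apply: (twin u x) => //; exact: D1.
  (* Now [s] and [q] are adjacent non-neighbours of [v], hence twins away from [t], so [q] covers
     what [s] covers there. *)
  have [q [qA nqt qt]] : exists q, [/\ q \in A, q != t & adj q t].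
    have [ewt|nwt] := eqVneq w t; last by exists w.
    by exists u; split=> //; rewrite -ewt adj_sym.
  have nvF : v \notin F by apply: contra nsv => vF; apply: nearF.
  have nvq : ~~ adj v q by apply: contra nvF; rewrite adj_sym; exact: far.
  exists q; [exact: D1|split=> //; apply: Fcov; rewrite ?qt ?orbT // => x xA nxt sx].
  have sq : adj s q by apply: nearF => //; apply: (far q) => //; exact: adjxx.
  apply/orP; right; rewrite adj_sym; apply: (spv s q q x); rewrite ?D1 ?adjxx //.
  - by rewrite adj_sym.
  - by rewrite adj_sym.
  - by rewrite adj_sym.
case: qt => qt covF; have [_ qA] := setD1P qA1.
apply: viaS => r rA vr; apply: (subsetP (maxcov v q vA qA covF)).
by rewrite inE rA vr.
Qed.

(** Being spread excludes the first kind of obstruction. In the second, [w] and [w'] cover the seven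
    vertices, but each of the seven leaves two non-neighbours that are not twins. *)
Lemma spread_good A v : two_perfect -> spread A v -> good A v.
Proof.
move=> perf2 [vA spv]; split=> // u u' w w' x y uA u'A wA w'A xA yA.
apply/negP => /and5P[vu vu' wu w'u']; case: ifPn => [wu'|nwu'].
  by rewrite (spv u' u w w').
case/and5P=> vw vw' vx vy /and4P[wx nw'x w'y nwy].
have far z : z \in A -> adj z u -> ~~ adj z u'.
  by move=> zA zu; apply: contra nwu' => zu'; apply: (spv u u' z w).
have nuu' : ~~ adj u u' by apply: far; rewrite ?adjxx.
have nw'u : ~~ adj w' u by apply: contraL w'u'; exact: far.
pose F := [set z in [:: u; u'; w; w'; x; y; v]].
have [uF u'F wF w'F] : [/\ u \in F, u' \in F, w \in F & w' \in F] by rewrite !inE !eqxx !orbT.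
have [xF yF vF] : [/\ x \in F, y \in F & v \in F] by rewrite !inE !eqxx !orbT.
have [|p pF cot] := perf2 F w w' wF w'F.
  move=> z; rewrite !inE => /or4P[||| /or4P[]] /eqP->;
  by rewrite ?wu ?w'u' ?adjxx ?wx ?w'y ?(adj_sym w v) ?vw ?orbT.
have sep t t' z : t \in F -> t' \in F -> z \in F -> ~~ adj p t -> ~~ adj p t' ->
    adj z t -> ~~ adj z t' -> False.
  by move=> tF t'F zF pt pt' zt /negP[]; exact: (cot t t' z).
move: pF; rewrite !inE => /or4P[||| /or4P[]] /eqP ep; rewrite ep in sep.
- by apply: (sep v u' v) => //; rewrite ?adjxx // adj_sym.
- by apply: (sep v u v) => //; rewrite ?adjxx // adj_sym.
- by apply: (sep y u' v).
- by apply: (sep x u v).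
- have [xu'|nxu'] := boolP (adj x u').
    have nxu : ~~ adj x u by apply: contraL xu'; exact: far.
    by apply: (sep w' u w') => //; rewrite ?adjxx // adj_sym.
  by apply: (sep w' u' v) => //; rewrite adj_sym.
- have [yu|nyu] := boolP (adj y u).
    have nyu' := far y yA yu.
    by apply: (sep w u' w) => //; rewrite ?adjxx // adj_sym.
  by apply: (sep w u v) => //; rewrite adj_sym.
- by apply: (sep u u' u); rewrite ?adjxx.
Qed.

End GraphTheory.

(** * Transfer to induced subgraphs *)

Section Perfect.
Variable G : sgraph.
Implicit Types A : {set G}.

Lemma adj_induced A (x y : induced A) : adj x y = adj (val x) (val y).
Proof. by rewrite /adj /= val_eqE. Qed.

Lemma card_induced_gt0 A : A != set0 -> 0 < #|induced A|.
Proof. by case/set0Pn=> a aA; apply/card_gt0P; exists (Sub a aA). Qed.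

Lemma good_induced A v : good A v -> gamma_g (induced A) = gamma (induced A).
Proof.
case=> vA gA; apply: (@good_gamma_g _ (Sub v vA : induced A)); split; first by rewrite inE.
move=> u u' w w' x y _ _ _ _ _ _; rewrite /obstruction !adj_induced /=.
by apply: gA; exact: valP.
Qed.

Lemma perfect_two_perfect : gamma_g_perfect G -> two_perfect G.
Proof.
move=> perf F a b aF bF dom.
have nF : F != set0 by apply/set0Pn; exists a.
pose a' : induced F := Sub a aF; pose b' : induced F := Sub b bF.
have [|s cot] := gamma_g_le2 (card_induced_gt0 nF).
  rewrite perf //; have domI : dominating [set a'; b'].
    apply/eqP/setP => x; rewrite inE; apply/dominatedP.
    by have /orP[ax|bx] := dom _ (valP x); [exists a'|exists b'];
      rewrite ?inE ?eqxx ?orbT // adj_induced.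
  by apply: leq_trans (gamma_le domI) _; rewrite cards2; case: (_ != _).
exists (val s); first exact: valP.
move=> t t' z tF t'F zF; have := cot (Sub t tF) (Sub t' t'F) (Sub z zF).
by rewrite !adj_induced !inE /=; apply.
Qed.

Lemma perfect_good : gamma_g_perfect G -> forall A, A != set0 -> exists v, good A v.
Proof.
move=> /perfect_two_perfect perf2 A /(spread_exists perf2)[v spv].
by exists v; exact: spread_good.
Qed.

End Perfect.

(** * Greedy elimination *)

Section Elimination.
Variable G : sgraph.
Implicit Types (A B D : {set G}) (v : G).

Definition blocked A v :=
  [exists u, exists u', exists w, exists w', exists x, exists y,
     all (mem A) [:: u; u'; w; w'; x; y] && obstruction (@adj G) v u u' w w' x y].

Lemma goodP A v : good A v <-> v \in A /\ ~~ blocked A v.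
Proof.
split=> -[vA gA]; split=> //.
  apply/existsPn => u; apply/existsPn => u'; apply/existsPn => w; apply/existsPn => w'.
  apply/existsPn => x; apply/existsPn => y; rewrite negb_and -implybE.
  by apply/implyP => /and5P[? ? ? ? /andP[? /andP[? _]]]; exact: gA.
move=> u u' w w' x y uA u'A wA w'A xA yA; apply: contra gA => obs.
apply/existsP; exists u; apply/existsP; exists u'; apply/existsP; exists w.
apply/existsP; exists w'; apply/existsP; exists x; apply/existsP; exists y.
by rewrite /= uA u'A wA w'A xA yA.
Qed.

Definition eliminate D v := if blocked (~: D) v then D else v |: D.
Definition round D := foldl eliminate D (enum G).

Lemma sub_eliminate D vs : D \subset foldl eliminate D vs.
Proof.
elim: vs D => //= v vs IHvs D; apply: subset_trans (IHvs _).
by rewrite /eliminate; case: ifP => // _; exact: subsetUr.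
Qed.

(** Goodness survives earlier deletions, so [v] is still good when its turn comes, unless already
    deleted. *)
Lemma good_eliminate D vs v :
  v \in vs -> good (~: D) v -> v \in foldl eliminate D vs.
Proof.
elim: vs D => //= v1 vs IHvs D; rewrite inE => /predU1P[<-|v_vs] gv.
  apply: (subsetP (sub_eliminate _ _)); have [_ nb] := (goodP _ _).1 gv.
  by rewrite /eliminate (negbTE nb) setU11.
have [v1D|nv] := boolP (v \in eliminate D v1); first exact: (subsetP (sub_eliminate _ _)).
apply: IHvs => //; apply: good_sub gv; last by rewrite inE.
by rewrite setCS; exact: (sub_eliminate D [:: v1]).
Qed.

Definition settled D := forall B, ~~ (B \subset ~: D) ->
  gamma_g (induced B) = gamma (induced B).

(** A set [B] first met by the deletion of [v] lies among the vertices remaining before it, so [v]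
    is good in [B] too. *)
Lemma settled_eliminate D vs : settled D -> settled (foldl eliminate D vs).
Proof.
elim: vs D => //= v vs IHvs D setD; apply: IHvs; rewrite /eliminate.
case: ifPn => // nb B; have [sBD|/setD //] := boolP (B \subset ~: D).
case/subsetPn=> x xB; rewrite !inE negbK => /predU1P[exv|xD]; last first.
  by have := subsetP sBD x xB; rewrite inE xD.
rewrite {}exv in xB; apply: (good_induced (v := v)); apply: (good_sub sBD) => //.
by apply/goodP; split=> //; exact: (subsetP sBD).
Qed.

Lemma round_progress D : gamma_g_perfect G -> D != setT -> #|D| < #|round D|.
Proof.
move=> perf nD; apply: proper_card; apply/properP; split; first exact: sub_eliminate.
have nCD : ~: D != set0 by apply: contraNneq nD => CD; rewrite -(setCK D) CD setC0.
have [v gv] := perfect_good perf nCD.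
exists v; first by apply: good_eliminate; rewrite ?mem_enum.
by have [] := gv; rewrite inE.
Qed.

(** In a perfect graph each round deletes a vertex while any remains, so [#|G|] rounds suffice. *)
Lemma elimination_correct :
  iter #|G| round set0 = setT <-> gamma_g_perfect G.
Proof.
split=> [DT B /set0Pn[b bB] | perf].
  suff: settled (iter #|G| round set0).
    by rewrite DT; apply; apply/subsetPn; exists b; rewrite ?inE.
  elim: #|G| => [B' | k IHk /=]; last exact: settled_eliminate.
  by rewrite setC0 subsetT.
have: #|G| <= #|iter #|G| round set0|.
  suff le k : k <= #|G| -> k <= #|iter k round set0| by exact: le.
  elim: k => //= k IHk ltk.
  have [DT|/(round_progress perf)] := eqVneq (iter k round set0) setT; last first.
    by apply: leq_ltn_trans; exact/IHk/ltnW.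
  apply: leq_trans ltk _; rewrite -cardsT -DT; apply: subset_leq_card.
  exact: sub_eliminate.
by move=> leG; apply/eqP; rewrite eqEcard subsetT cardsT.
Qed.

End Elimination.

(** * The recognition program *)

Definition poly_bounded (f : nat -> nat) :=
  exists p : {poly nat}, forall n, f n <= (p.[n])%R.

Lemma poly_bounded_const c : poly_bounded (fun _ => c).
Proof. by exists (polyC c) => n; rewrite hornerC. Qed.

Lemma poly_bounded_id : poly_bounded id.
Proof. by exists 'X%R => n; rewrite hornerX. Qed.

Lemma poly_bounded_add f g :
  poly_bounded f -> poly_bounded g -> poly_bounded (fun n => f n + g n).
Proof. by move=> [p fp] [q gq]; exists (p + q)%R => n; rewrite hornerD leq_add. Qed.

Lemma poly_bounded_mul f g :
  poly_bounded f -> poly_bounded g -> poly_bounded (fun n => f n * g n).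
Proof. by move=> [p fp] [q gq]; exists (p * q)%R => n; rewrite hornerM leq_mul. Qed.

(* Program variable [k] keeps its value in register [idx k] and its value times
   the order of the graph in register [row k]; registers 0 and 1 hold the order
   and a flag. *)
Definition idx k := k.*2.+2.
Definition row k := k.*2.+3.

Notation memory := Defs.mem.

Definition var (s : state) k := regs s (idx k).

(** The machine cannot multiply, so the products needed in addresses are maintained by repeated
    addition. *)
Definition ready n s :=
  regs s 0 = n /\ forall k, regs s (row k) = var s k * n.

Definition set_var n k i s := set_reg (set_reg s (idx k) i) (row k) (i * n).

Lemma idx_eq j k : (idx j == idx k) = (j == k).
Proof. by rewrite /idx !eqSS; apply/eqP/eqP => [/double_inj|->]. Qed.
Lemma row_eq j k : (row j == row k) = (j == k).
Proof. by rewrite /row !eqSS; apply/eqP/eqP => [/double_inj|->]. Qed.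
Lemma idx_row j k : (idx j == row k) = false.
Proof.
rewrite /row /idx !eqSS; apply/eqP => /(congr1 odd).
by rewrite /= !odd_double.
Qed.
Lemma row_idx j k : (row j == idx k) = false.
Proof. by rewrite eq_sym idx_row. Qed.

Lemma var_set_var n k i s j : var (set_var n k i s) j = if j == k then i else var s j.
Proof. by rewrite /var /= idx_row idx_eq. Qed.

Lemma ready_set_var n k i s : ready n s -> ready n (set_var n k i s).
Proof.
case=> n0 rs; split=> // j; rewrite var_set_var /= row_idx row_eq.
by case: eqP.
Qed.

(** * Counted loops *)

Definition for_loop k body :=
  While (Defs.Sub (Reg 0) (Reg (idx k)))
    (Seq body (Seq (SetReg (idx k) (Add (Reg (idx k)) (Const 1)))
                   (SetReg (row k) (Add (Reg (row k)) (Reg 0))))).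

Definition For k body :=
  Seq (SetReg (idx k) (Const 0)) (Seq (SetReg (row k) (Const 0)) (for_loop k body)).

(** Per iteration: 4 for the test, 4 for each of two increments, 2 for the two [Seq]. The final 10
    are 6 for the initialisation and 4 for the failing test. *)
Definition for_time n T := n * (T + 14) + 10.

(** [I] must survive assignments to variable [k], since the loop itself resets and advances it. *)
Lemma for_spec n k body T (I : nat -> state -> Prop) s :
    (forall i x s1, I i s1 -> I i (set_var n k x s1)) ->
    (forall i s1, i < n -> ready n s1 -> var s1 k = i -> I i s1 ->
       exists t s2, [/\ exec body s1 t s2, t <= T, ready n s2, var s2 k = i & I i.+1 s2]) ->
    ready n s -> I 0 s ->
  exists t s', [/\ exec (For k body) s t s', t <= for_time n T,
                   ready n s', var s' k = n & I n s'].
Proof.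
move=> Iset Ibody rs I0.
suff loop d i s1 : i + d = n -> ready n s1 -> var s1 k = i -> I i s1 ->
    exists t s', [/\ exec (for_loop k body) s1 t s', t <= d * (T + 14) + 4,
                     ready n s', var s' k = n & I n s'].
  have [||||t [s' [ex le_t rs' vs' Is']]] := loop n 0 (set_var n k 0 s).
  - by rewrite add0n.
  - exact: ready_set_var.
  - by rewrite var_set_var eqxx.
  - exact: Iset.
  exists (2 + (2 + t).+1).+1, s'; split=> //; last first.
    by rewrite /for_time; lia.
  by apply: (exec_Seq (t1 := 2)); [|apply: (exec_Seq (t1 := 2)); [|exact: ex]]; exact: exec_SetReg.
elim: d i s1 => [|d IHd] i s1.
  rewrite addn0 => ein rs1 vs1 Is1; exists 4, s1; split=> //; last by rewrite -ein.
  - by apply: exec_While_stop; rewrite /= -/(var s1 k) vs1 (proj1 rs1) ein subnn.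
  - by rewrite -ein.
rewrite addnS -addSn => eSin rs1 vs1 Is1.
have ltin : i < n by rewrite -eSin leq_addr.
have [t1 [s2 [ex1 le_t1 rs2 vs2 Is2]]] := Ibody i s1 ltin rs1 vs1 Is1.
have [|||t2 [s3 [ex2 le_t2 rs3 vs3 Is3]]] := IHd i.+1 (set_var n k i.+1 s2) eSin.
- exact: ready_set_var.
- by rewrite var_set_var eqxx.
- exact: Iset.
exists (3 + (t1 + (4 + 4).+1).+1 + t2).+1, s3; split=> //; last first.
  by rewrite mulSn; lia.
apply: exec_While_loop ex2; first by rewrite /= -/(var s1 k) vs1 (proj1 rs1) subn_eq0 -ltnNge.
apply: exec_Seq ex1 _.
pose s' := set_reg s2 (idx k) (eval s2 (Add (Reg (idx k)) (Const 1))).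
have -> : set_var n k i.+1 s2 =
    set_reg s' (row k) (eval s' (Add (Reg (row k)) (Reg 0))).
  rewrite /s' /set_var /= row_idx -/(var s2 k) vs2 (proj2 rs2) vs2 (proj1 rs2).
  by rewrite addn1 mulSn addnC.
exact: exec_Seq (exec_SetReg _ _ _) (exec_SetReg _ _ _).
Qed.

(** * Boolean expressions, with nonzero as true *)

Definition NotE e := Defs.Sub (Const 1) e.
Definition OrE e1 e2 := Add e1 e2.
Definition AndE e1 e2 := NotE (OrE (NotE e1) (NotE e2)).

Definition truth (s : state) (e : expr) : bool := eval s e != 0.

Lemma truth_Not s e : truth s (NotE e) = ~~ truth s e.
Proof. by rewrite /truth /=; case: (eval s e). Qed.
Lemma truth_Or s e1 e2 : truth s (OrE e1 e2) = truth s e1 || truth s e2.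
Proof. by rewrite /truth /= addn_eq0 negb_and. Qed.
Lemma truth_And s e1 e2 : truth s (AndE e1 e2) = truth s e1 && truth s e2.
Proof. by rewrite truth_Not truth_Or !truth_Not negb_or !negbK. Qed.

Definition CellE j k := Defs.Mem (Add (Reg (row j)) (Reg (idx k))).
(** Equality is tested by both truncated differences being 0. *)
Definition AdjE j k :=
  OrE (NotE (OrE (Defs.Sub (Reg (idx j)) (Reg (idx k))) (Defs.Sub (Reg (idx k)) (Reg (idx j)))))
      (CellE j k).

Definition cell n (m : nat -> nat) i j := m (i * n + j) != 0.
Definition adj_at n m i j := (j == i) || cell n m i j.

Lemma truth_Cell n s j k : ready n s ->
  truth s (CellE j k) = cell n (memory s) (var s j) (var s k).
Proof. by case=> _ rs; rewrite /truth /= rs. Qed.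

Lemma truth_Adj n s j k : ready n s ->
  truth s (AdjE j k) = adj_at n (memory s) (var s j) (var s k).
Proof.
move=> rs; rewrite truth_Or (truth_Cell _ _ rs) truth_Not truth_Or /adj_at; congr (_ || _).
by rewrite /truth /= -!/(var s _) !subn_eq0 -!ltnNge; case: ltngtP.
Qed.

Definition ObstructionE v u u' w w' x y :=
  AndE (NotE (AdjE v u)) (AndE (NotE (AdjE v u')) (AndE (AdjE w u) (AndE (AdjE w' u')
    (OrE (AndE (AdjE w u') (NotE (AdjE w' u)))
         (AndE (NotE (AdjE w u')) (AndE (AdjE v w) (AndE (AdjE v w') (AndE (AdjE v x)
            (AndE (AdjE v y) (AndE (AdjE w x) (AndE (NotE (AdjE w' x))
            (AndE (AdjE w' y) (NotE (AdjE w y)))))))))))))).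

Lemma truth_Obstruction n s v u u' w w' x y : ready n s ->
  truth s (ObstructionE v u u' w w' x y) =
  obstruction (adj_at n (memory s)) (var s v) (var s u) (var s u') (var s w)
    (var s w') (var s x) (var s y).
Proof.
move=> rs; rewrite /obstruction; rewrite !(truth_Adj _ _ rs, truth_And, truth_Not, truth_Or).
by case: (adj_at n (memory s) (var s w) (var s u')); rewrite /= ?orbF.
Qed.

(** * Exhaustive search by nested loops *)

Fixpoint search ks e :=
  if ks is k :: ks' then For k (search ks' e) else If e (SetReg 1 (Const 1)) Skip.

Fixpoint search_time c m n :=
  if m is m'.+1 then for_time n (search_time c m' n) else c.

Fixpoint found n (psi : (nat -> nat) -> bool) ks (f : nat -> nat) :=
  if ks is k :: ks' then has (fun i => found n psi ks' [eta f with k |-> i]) (iota 0 n)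
  else psi f.

Lemma found_ext n psi ks f g :
    (forall f' g', f' =1 g' -> psi f' = psi g') ->
    (forall j, j \notin ks -> f j = g j) ->
  found n psi ks f = found n psi ks g.
Proof.
move=> psi_ext; elim: ks f g => /= [|k ks IHks] f g efg.
  by apply: psi_ext => j; exact: efg.
apply: eq_has => i; apply: IHks => j nj /=; case: eqP => // /eqP njk.
by apply: efg; rewrite inE negb_or njk.
Qed.

(** The search only ever raises the flag, so it is enough to track whether a witness occurred in the
    iterations done so far. *)
Lemma search_spec n psi ks e s :
    (forall f g, f =1 g -> psi f = psi g) ->
    (forall s', ready n s' -> memory s' = memory s -> truth s' e = psi (var s')) ->
    ready n s -> uniq ks ->
  exists t s', [/\ exec (search ks e) s t s',
    t <= search_time (cost e + 3) (size ks) n, ready n s', memory s' = memory s &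
    (forall j, j \notin ks -> var s' j = var s j) /\
    regs s' 1 = if found n psi ks (var s) then 1 else regs s 1].
Proof.
move=> psi_ext; elim: ks s => [|k ks IHks] s psiE rs /=.
  move=> _; rewrite -(psiE s rs erefl); case: ifP => es.
    exists (cost e + 2).+1, (set_reg s 1 1); split=> //; last by lia.
    by apply: exec_If; rewrite -/(truth s e) es; exact: exec_SetReg.
  exists (cost e + 1).+1, s; split=> //; last by lia.
  by apply: exec_If; rewrite -/(truth s e) es; exact: exec_Skip.
case/andP=> k_ks uniq_ks.
pose I i s1 := [/\ memory s1 = memory s, forall j, j \notin k :: ks -> var s1 j = var s j &
  regs s1 1 = if has (fun i' => found n psi ks [eta var s with k |-> i']) (iota 0 i)
              then 1 else regs s 1].
have [i x s1 [? vars ?]|i s1 ltin rs1 vs1 [mem1 vars1 reg1]||t [s' [ex le_t rs' vs' [? ? ?]]]] :=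
  @for_spec n k (search ks e) (search_time (cost e + 3) (size ks) n) I s _ _ rs _.
- split=> // j nj; rewrite var_set_var; case: eqP nj => [->|_]; last exact: vars.
  by rewrite mem_head.
- have [|t [s2 [ex le_t rs2 mem2 [vars2 reg2]]]] := IHks s1 _ rs1 uniq_ks.
    by move=> s' rs'; rewrite mem1; exact: psiE.
  exists t, s2; split=> //; first by rewrite vars2.
  split; first by rewrite mem2.
    by move=> j; rewrite inE negb_or => /andP[njk nj]; rewrite vars2 // vars1 // inE negb_or njk.
  rewrite reg2 reg1 -(addn1 i) iotaD has_cat /= orbF add0n.
  rewrite (@found_ext n psi ks (var s1) [eta var s with k |-> i]) //; last first.
    move=> j nj /=; case: eqP => [->//|/eqP njk].
    by apply: vars1; rewrite inE negb_or njk.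
  by case: has; case: found.
- by split.
by exists t, s'; split.
Qed.

(** * The program and its time bounds *)

Definition BlockedE :=
  AndE (NotE (OrE (OrE (OrE (CellE 7 1) (CellE 7 2)) (OrE (CellE 7 3) (CellE 7 4)))
                  (OrE (CellE 7 5) (CellE 7 6))))
       (ObstructionE 0 1 2 3 4 5 6).

(** With the order [n] in variable 7, [row 7] holds [n * n], so the store hits the flag of the
    tested vertex. *)
Definition Eliminate :=
  Seq (SetReg 1 (Const 0)) (Seq (search (iota 1 6) BlockedE)
    (If (Reg 1) Skip (Store (Add (Reg (row 7)) (Reg (idx 0))) (Const 1)))).

Definition Round := For 0 Eliminate.

(* The first loop only sets variable 7 to the order of the graph, so that
   [CellE 7 j] reads the deletion flag of [j]. *)
Definition Recognize :=
  Seq (For 7 Skip) (Seq (For 8 Round) (Seq (SetReg 1 (Const 0))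
    (Seq (search [:: 0] (NotE (CellE 7 0)))
         (SetReg 0 (NotE (Reg 1)))))).

Definition eliminate_time n := search_time (cost BlockedE + 3) 6 n + 12.
Definition round_time n := for_time n (eliminate_time n).
Definition recognize_time n :=
  for_time n 1 + for_time n (round_time n)
  + search_time (cost (NotE (CellE 7 0)) + 3) 1 n + 20.

(** * Correctness of the program *)

Section Correctness.
Variables (G : sgraph) (x0 : G).
Implicit Types (D : {set G}) (s : state).

Definition vtx i : G := nth x0 (enum G) i.

(* Row [n] of the [n]-column matrix in memory flags the eliminated vertices. *)
Definition encodes D (m : nat -> nat) := forall j, j < #|G| ->
  (forall i, i < #|G| -> m (i * #|G| + j) = edge (vtx i) (vtx j)) /\
  m (#|G| * #|G| + j) = (vtx j \in D).

Lemma vtx_eq i j : i < #|G| -> j < #|G| -> (vtx i == vtx j) = (i == j).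
Proof. by move=> iG jG; rewrite nth_uniq ?enum_uniq -?cardE. Qed.

Lemma index_vtx x : exists2 i, i < #|G| & vtx i = x.
Proof.
exists (index x (enum G)); first by rewrite cardE index_mem mem_enum.
by rewrite /vtx nth_index ?mem_enum.
Qed.

Lemma has_vtx (p : pred nat) (q : pred G) :
  (forall i, i < #|G| -> p i = q (vtx i)) -> has p (iota 0 #|G|) = [exists x, q x].
Proof.
move=> pq; apply/hasP/existsP => [[i]|[x qx]].
  by rewrite mem_iota add0n => /= iG pi; exists (vtx i); rewrite -pq.
have [i iG vi] := index_vtx x; exists i; first by rewrite mem_iota add0n.
by rewrite pq // vi.
Qed.

Lemma encodes_input : encodes set0 (Defs.mem (input_state G)).
Proof.
move=> j jG /=; rewrite inE.
(* Generalised to a list [r] of rows, so that induction peels off one row of the matrix. *)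
have nth_pairs (r : seq G) i : i < size r ->
    nth 0 [seq nat_of_bool (edge x y) | x <- r, y <- enum G] (i * #|G| + j) =
    edge (nth x0 r i) (vtx j).
  elim: r i => // x r IHr [|i] ltir /=; rewrite nth_cat size_map -cardE.
    by rewrite jG (nth_map x0) // -cardE.
  by rewrite mulSn -addnA ltnNge leq_addr /= addKn IHr.
split=> [i iG|]; first by rewrite nth_pairs // -cardE.
(* Flags lie past the end of the input, where the default 0 means not deleted. *)
by rewrite nth_default // size_allpairs -!cardE leq_addr.
Qed.

Lemma encodes_adj D m i j : encodes D m -> i < #|G| -> j < #|G| ->
  adj_at #|G| m i j = adj (vtx i) (vtx j).
Proof.
move=> encD iG jG; have [/(_ i iG) mij _] := encD j jG.
by rewrite /adj_at /adj /cell mij eqb0 negbK vtx_eq.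
Qed.

Lemma encodes_cell D m j : encodes D m -> j < #|G| ->
  cell #|G| m #|G| j = (vtx j \in D).
Proof. by move=> encD jG; have [_ mj] := encD j jG; rewrite /cell mj eqb0 negbK. Qed.

Lemma encodes_set D s i : encodes D (Defs.mem s) -> i < #|G| ->
  encodes (vtx i |: D) (Defs.mem (set_mem s (#|G| * #|G| + i) 1)).
Proof.
move=> encD iG j jG; have [edges flag] := encD j jG; split=> [k kG|] /=.
  (* The written address lies beyond every matrix entry. *)
  rewrite ltn_eqF ?edges //; apply: leq_trans (leq_addr _ _).
  by apply: leq_trans (leq_mul kG (leqnn _)); rewrite mulSn addnC ltn_add2r.
by rewrite eqn_add2l flag !inE vtx_eq //; case: eqP.
Qed.

Definition psi (m f : nat -> nat) :=
  ~~ [|| cell #|G| m (f 7) (f 1), cell #|G| m (f 7) (f 2), cell #|G| m (f 7) (f 3),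
         cell #|G| m (f 7) (f 4), cell #|G| m (f 7) (f 5) | cell #|G| m (f 7) (f 6)] &&
  obstruction (adj_at #|G| m) (f 0) (f 1) (f 2) (f 3) (f 4) (f 5) (f 6).

Lemma found_blocked D m f : encodes D m -> f 0 < #|G| -> f 7 = #|G| ->
  found #|G| (psi m) (iota 1 6) f = blocked (~: D) (vtx (f 0)).
Proof.
move=> encD f0 f7; rewrite /blocked.
do 6!(apply: has_vtx => ? ?).
rewrite /psi /= f7 !(encodes_cell encD) // /obstruction !(encodes_adj encD) //.
by rewrite !inE !negb_or andbT.
Qed.

Lemma eliminate_spec D s :
    ready #|G| s -> encodes D (Defs.mem s) -> var s 0 < #|G| -> var s 7 = #|G| ->
  exists t s', [/\ exec Eliminate s t s', t <= eliminate_time #|G|, ready #|G| s',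
    encodes (eliminate D (vtx (var s 0))) (Defs.mem s') &
    forall j, j \notin iota 1 6 -> var s' j = var s j].
Proof.
move=> rs encD s0 s7; pose s1 := set_reg s 1 0.
have rs1 : ready #|G| s1 by [].
have [|||t [s2 [ex le_t rs2 mem2 [vars2 reg2]]]] :=
  @search_spec #|G| (psi (Defs.mem s)) (iota 1 6) BlockedE s1 _ _ rs1 _ => //.
- by move=> f g efg; rewrite /psi !efg.
- move=> s' rs' mem'; rewrite truth_And truth_Not !truth_Or !(truth_Cell _ _ rs').
  by rewrite (truth_Obstruction _ _ _ _ _ _ _ rs') mem' /psi -!orbA.
rewrite -[size _]/6 in le_t.
rewrite (found_blocked (f := var s1) encD) //= in reg2.
have ex1 := exec_SetReg 1 (Const 0) s.
rewrite /eliminate -/(var s1 0); case: ifP reg2 => [_|_] reg2.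
  exists (2 + (t + (1 + 1).+1).+1).+1, s2; split=> //; last by rewrite mem2.
    apply: exec_Seq ex1 _; apply: exec_Seq ex _; apply: exec_If.
    by rewrite /= reg2; exact: exec_Skip.
  by rewrite /eliminate_time; lia.
exists (2 + (t + (1 + (3 + 1).+1).+1).+1).+1, (set_mem s2 (#|G| * #|G| + var s1 0) 1).
split=> //; last by rewrite -mem2 in encD; exact: encodes_set.
  apply: exec_Seq ex1 _; apply: exec_Seq ex _; apply: exec_If.
  rewrite /= reg2 /=.
  have -> : #|G| * #|G| + var s1 0 = eval s2 (Add (Reg (row 7)) (Reg (idx 0))).
    by rewrite -[eval _ _]/(regs s2 (row 7) + var s2 0) (proj2 rs2) !vars2 // [var s1 7]s7.
  exact: exec_Store.
by rewrite /eliminate_time; lia.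
Qed.

Lemma round_spec D s : ready #|G| s -> encodes D (Defs.mem s) -> var s 7 = #|G| ->
  exists t s', [/\ exec Round s t s', t <= round_time #|G|, ready #|G| s',
    encodes (round D) (Defs.mem s') & var s' 7 = #|G| /\ var s' 8 = var s 8].
Proof.
move=> rs encD s7.
pose I i s' := [/\ encodes (foldl (@eliminate G) D (take i (enum G))) (Defs.mem s'),
  var s' 7 = #|G| & var s' 8 = var s 8].
have [i x s1 [] *|i s1 ltin rs1 vs1 [enc1 s17 s18]||t [s' [ex le_t rs' _ [enc' s'7 s'8]]]] :=
  @for_spec #|G| 0 Eliminate (eliminate_time #|G|) I s _ _ rs _.
- by split; rewrite ?var_set_var.
- have [|t [s2 [ex le_t rs2 enc2 vars2]]] := eliminate_spec rs1 enc1 _ s17; first by rewrite vs1.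
  exists t, s2; split=> //; first by rewrite vars2.
  split; rewrite ?vars2 //.
  by rewrite (take_nth x0) -?cardE // -cats1 foldl_cat /= -/(vtx i); rewrite vs1 in enc2.
- by split; rewrite ?take0.
by exists t, s'; split=> //; rewrite /round -(take_size (enum G)) -cardE.
Qed.

Lemma recognize_spec : exists t s', [/\ exec Recognize (input_state G) t s',
  t <= recognize_time #|G| &
  accepting s' <-> iter #|G| (@round G) set0 = setT].
Proof.
have rs0 : ready #|G| (input_state G) by split=> // k; rewrite /var /= mul0n.
pose I0 (i : nat) s := Defs.mem s = Defs.mem (input_state G).
have [//|i s _ rs vs Is|//|t1 [s1 [ex1 le_t1 rs1 s17 mem1]]] :=
  @for_spec #|G| 7 Skip 1 I0 (input_state G) _ _ rs0 _.
  by exists 1, s; split=> //; exact: exec_Skip.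
pose I i s := encodes (iter i (@round G) set0) (Defs.mem s) /\ var s 7 = #|G|.
have [i x s []|i s ltin rs vs [enc s7]||t2 [s2 [ex2 le_t2 rs2 _ [enc2 s27]]]] :=
  @for_spec #|G| 8 Round (round_time #|G|) I s1 _ _ rs1 _.
- by rewrite /I var_set_var.
- have [t [s' [ex le_t rs' enc' [s'7 s'8]]]] := round_spec rs enc s7.
  by exists t, s'; split=> //; rewrite s'8.
- by split; rewrite // mem1; exact: encodes_input.
set D := iter _ _ _ in enc2 *.
pose s3 := set_reg s2 1 0; have rs3 : ready #|G| s3 by [].
(* The last search looks for a surviving vertex; the answer is its negated flag. *)
pose phi f := ~~ cell #|G| (Defs.mem s2) (f 7) (f 0).
have [|||t4 [s4 [ex4 le_t4 rs4 mem4 [vars4 reg4]]]] :=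
  @search_spec #|G| phi [:: 0] (NotE (CellE 7 0)) s3 _ _ rs3 _ => //.
- by move=> f g efg; rewrite /phi !efg.
- by move=> s' rs' mem'; rewrite truth_Not (truth_Cell _ _ rs') mem'.
exists (t1 + (t2 + (2 + (t4 + 4).+1).+1).+1).+1, (set_reg s4 0 (1 - regs s4 1)); split.
- apply: exec_Seq ex1 (exec_Seq ex2 (exec_Seq (exec_SetReg 1 (Const 0) s2) (exec_Seq ex4 _))).
  exact: (exec_SetReg 0 (NotE (Reg 1)) s4).
- by rewrite -[size _]/1 in le_t4; rewrite /recognize_time; lia.
have foundD : found #|G| phi [:: 0] (var s3) = [exists x, x \notin D].
  by apply: has_vtx => i iG; rewrite /phi /= -/(var s2 7) s27 (encodes_cell enc2).
rewrite /accepting /= reg4 foundD; split=> [acc|->].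
  apply/setP => x; rewrite inE; apply: contraT => xD; case: acc.
  by rewrite ifT //; apply/existsP; exists x.
by rewrite ifF //; apply/negbTE/existsPn => x; rewrite inE.
Qed.

End Correctness.

(** * Polynomial running time *)

Lemma for_time_poly f : poly_bounded f -> poly_bounded (fun n => for_time n (f n)).
Proof.
move=> pf; apply: poly_bounded_add; last exact: poly_bounded_const.
apply: poly_bounded_mul; first exact: poly_bounded_id.
by apply: poly_bounded_add pf _; exact: poly_bounded_const.
Qed.

Lemma search_time_poly c m : poly_bounded (search_time c m).
Proof. by elim: m => [|m IHm]; [exact: poly_bounded_const|exact: for_time_poly]. Qed.

Lemma recognize_time_poly : poly_bounded recognize_time.
Proof.
have const := poly_bounded_const; apply: poly_bounded_add (const 20).
apply: poly_bounded_add (search_time_poly _ 1).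
apply: poly_bounded_add (for_time_poly (const 1)) _; do 2!apply: for_time_poly.
by apply: poly_bounded_add (const 12); exact: (search_time_poly _ 6).
Qed.

Theorem theorem4p1 : polynomial_time_recognizable gamma_g_perfect.
Proof.
have [p pE] := recognize_time_poly; exists Recognize, p => G /card_gt0P[x0 _].
have [t [s [ex le_t acc]]] := recognize_spec x0.
exists t, s; split=> //; first exact: leq_trans le_t _.
by rewrite acc; exact: elimination_correct.
Qed.
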